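(* For any initial state $\varrho_0\in\mathcal{M}_+$, the Cauchy problem for $$\dot\varrho_t=b^{-2}\Delta\varrho_t-a^{-2}\langle\log\varrho_t,p\rangle_\varpi\,p$$ with initial value $\varrho_0$ at $t=0$ admits a unique global solution $\varrho\in\mathrm{C}^1([0,\infty);\mathcal{M}_+)$. Moreover, the trajectory $\{\varrho_t: t\ge 0\}$ is contained in a compact subset of $\mathcal{M}_+$.
   Context: Setting. $\mathcal{X}$ is a finite set with $N$ points, $K:\mathcal{X}\times\mathcal{X}\to[0,\infty)$ is an irreducible Markov kernel (row-stochastic matrix), and $\varpi:\mathcal{X}\to[0,\infty)$ is its unique steady-state probability distribution ($\varpi(x)=\sum_{y}\varpi(y)K(y,x)$, $\sum_y\varpi(y)=1$). $\varpi$ is assumed reversible: $K(x,y)\varpi(x)=K(y,x)\varpi(y)$ for all $x,y$. $\mathcal{M}_+=\{\mu:\mathcal{X}\to\mathbb{R}\mid\mu(x)>0\ \forall x\}$, an open subset of $\mathbb{R}^{\mathcal{X}}$. Fixed throughout: real numbers $a,b>0$ and $p\in\mathcal{M}_+$ with $\sum_x\varpi(x)p(x)=1$. Notation: $\langle\varphi,\psi\rangle_\varpi=\sum_x\varphi(x)\psi(x)\varpi(x)$ for $\varphi,\psi\in\mathbb{R}^{\mathcal{X}}$; $\log\varrho$ is taken pointwise; $\Delta\psi(x)=\sum_yK(x,y)(\psi(y)-\psi(x))$. *)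

(* Defs.v *)
From mathcomp Require Import all_boot all_order all_algebra.
From mathcomp Require Import all_classical all_reals all_analysis.
Set Implicit Arguments.
Unset Strict Implicit.
Unset Printing Implicit Defensive.
Import Order.TTheory GRing.Theory Num.Theory.
Import numFieldNormedType.Exports.
Local Open Scope classical_set_scope.
Local Open Scope ring_scope.

Section MarkovKernels.
Variables (R : realType) (X : finType).
Implicit Types (K : X -> X -> R) (w : X -> R).

Definition markov_kernel K : Prop :=
  (forall x y, 0 <= K x y) /\ (forall x, \sum_(y : X) K x y = 1).

Fixpoint kernel_pow K (n : nat) (x y : X) : R :=
  if n is m.+1 then \sum_(z : X) K x z * kernel_pow K m z y else (x == y)%:R.

Definition irreducible_kernel K : Prop :=
  forall x y, exists n : nat, 0 < kernel_pow K n x y.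

Definition steady_state K w : Prop :=
  [/\ forall x, 0 <= w x,
      \sum_(y : X) w y = 1
    & forall x, w x = \sum_(y : X) w y * K y x].

Definition reversible K w : Prop :=
  forall x y, K x y * w x = K y x * w y.

Definition laplacian K (psi : X -> R) : X -> R :=
  fun x => \sum_(y : X) K x y * (psi y - psi x).

Definition inner w (phi psi : X -> R) : R :=
  \sum_(x : X) phi x * psi x * w x.

End MarkovKernels.

(* Since X is finite, the topology of pointwise convergence carried by
   {ptws X -> R} is the usual topology of the vector space R^X. *)
Section CauchyProblem.
Variables (R : realType) (X : finType).

Definition Mplus : set {ptws X -> R} := [set mu | forall x, 0 < mu x].

(* Derivative relative to a set D of times; at an endpoint of D it is
   one-sided. *)
Definition has_derivative_within (D : set R) (f : R -> {ptws X -> R})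
    (t : R) (v : {ptws X -> R}) : Prop :=
  {ptws, (fun s => (s - t)^-1 *: (f s - f t)) @ within D t^' --> v}.

(* Curves in C^1([0, oo); M) are represented by functions on R of which only
   the restriction to [0, oo) is meaningful; df is the derivative of f. *)
Definition C1_halfline (M : set {ptws X -> R})
    (f df : R -> {ptws X -> R}) : Prop :=
  [/\ forall t : R, 0 <= t -> M (f t),
      forall t : R, 0 <= t -> has_derivative_within `[0, +oo[ f t (df t)
    & {within `[0, +oo[, continuous df}].

Definition vector_field (K : X -> X -> R) (w : X -> R) (a b : R) (p : X -> R)
    (rho : X -> R) : X -> R :=
  fun x => b ^- 2 * laplacian K rho x
           - a ^- 2 * inner w (fun y => ln (rho y)) p * p x.

Definition global_solution (K : X -> X -> R) (w : X -> R) (a b : R)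
    (p rho0 : X -> R) (rho : R -> {ptws X -> R}) : Prop :=
  rho 0 = rho0 /\
  exists drho : R -> {ptws X -> R},
    C1_halfline Mplus rho drho /\
    forall t : R, 0 <= t -> drho t = vector_field K w a b p (rho t).

End CauchyProblem.

(* Main.v *)
(* The logarithm is truncated below at a level d > 0, which makes the vector
   field globally Lipschitz, so Picard iteration gives a global solution. By
   reversibility and monotonicity of the truncated logarithm, the relative
   entropy decreases along it, which bounds the solution above by a constant M
   independent of d. Once M is known, d is chosen so small that at a point where
   the solution is minimal and below d the reaction term is positive; hence the
   solution never drops below d, and it solves the original equation. A second
   solution is bounded below on each compact time interval, so on that interval
   both solve one common truncated Lipschitz equation and agree. *)

Require Import Defs.
From mathcomp Require Import all_boot all_order all_algebra.
From mathcomp Require Import all_classical all_reals all_analysis.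
From mathcomp Require Import ring lra.
Import Order.TTheory GRing.Theory Num.Theory.
Import numFieldNormedType.Exports.
Local Open Scope classical_set_scope.
Local Open Scope ring_scope.

(** * Comparison of derivatives and primitives *)

Lemma half_pow_lt (R : realType) (C e : R) : 0 < e ->
  exists n, C * 2^-1 ^+ n < e.
Proof.
move=> e0; pose N := (Num.truncn (`|C| / e)).+1.
have h2 : 0 < (2 : R) ^+ N by rewrite exprn_gt0.
exists N; rewrite exprVn ltr_pdivrMr //.
apply: (le_lt_trans (ler_norm C)).
rewrite -ltr_pdivrMl // mulrC (lt_le_trans (truncnS_gt _)) //.
by rewrite -natrX ler_nat ltnW // ltn_expl.
Qed.

Lemma half_pow_eq0 (R : realType) (C x : R) :
  (forall n, `|x| <= C * 2^-1 ^+ n) -> x = 0.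
Proof.
move=> xC; apply/eqP; rewrite -normr_le0; apply/ler_addgt0Pr => e e0.
by have [n /ltW Cn] := half_pow_lt R C e e0; rewrite add0r (le_trans (xC n)).
Qed.

(** Monotonicity of [h + g] and [h - g] replaces an integral estimate. Derivatives are required only
    inside the interval, so curves with a one-sided derivative at 0 are covered. *)
Lemma dist_le_of_derive (R : realType) (g h dg dh : R -> R) (T : R) :
  0 <= T ->
  (forall t, t \in `]0, T[ -> is_derive t 1 g (dg t)) ->
  (forall t, t \in `]0, T[ -> is_derive t 1 h (dh t)) ->
  (forall t, t \in `]0, T[ -> `|dg t| <= dh t) ->
  {within `[0, T], continuous g} -> {within `[0, T], continuous h} ->
  `|g T - g 0| <= h T - h 0.
Proof.
move=> T0 Dg Dh gh cg ch.
have mono (k dk : R -> R) : (forall t, t \in `]0, T[ -> is_derive t 1 k (dk t)) ->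
    (forall t, t \in `]0, T[ -> 0 <= dk t) -> {within `[0, T], continuous k} ->
    k 0 <= k T.
  move=> Dk k0 ck; apply: (@ger0_derive1_ndecr _ k 0 T) => // t tT.
    by have [] := Dk _ tT.
  by rewrite derive1E; have [_ ->] := Dk _ tT; exact: k0.
rewrite ler_norml; apply/andP; split.
- have := mono (h + g) (fun t => dh t + dg t).
  rewrite !fctE => H; rewrite -subr_ge0.
  suff : h 0 + g 0 <= h T + g T by lra.
  apply: H => [t tT|t tT|].
  + have := Dg _ tT; have := Dh _ tT; exact: is_deriveD.
  + by have := gh _ tT; rewrite ler_norml => /andP[+ _]; lra.
  + by move=> t; apply: cvgD; [exact: ch|exact: cg].
- have := mono (h - g) (fun t => dh t - dg t).
  rewrite !fctE => H; suff : h 0 - g 0 <= h T - g T by lra.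
  apply: H => [t tT|t tT|].
  + have := Dg _ tT; have := Dh _ tT; exact: is_deriveB.
  + by have := gh _ tT; rewrite ler_norml => /andP[_ ]; lra.
  + by move=> t; apply: cvgB; [exact: ch|exact: cg].
Qed.

(* Based at -1 so that it is differentiable on both sides at 0. *)
Definition primitive (R : realType) (f : R -> R) (t : R) : R :=
  \int[lebesgue_measure]_(s in `[-1, t]) f s -
  \int[lebesgue_measure]_(s in `[-1, 0]) f s.

Lemma primitive0 (R : realType) (f : R -> R) : primitive R f 0 = 0.
Proof. exact: subrr. Qed.

Lemma is_derive_primitive (R : realType) (f : R -> R) (t : R) :
  continuous f -> 0 <= t -> is_derive t 1 (primitive R f) (f t).
Proof.
move=> cf t0.
have intf : lebesgue_measure.-integrable `[-1, t + 1] (EFin \o f).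
  apply: continuous_compact_integrable; first exact: segment_compact.
  exact: continuous_subspaceT.
have tt : t < t + 1 by rewrite ltrDl.
have t1 : -1 < t by rewrite (lt_le_trans _ t0) // ltrN10.
have [dF F'] := continuous_FTC1_closed tt intf t1 (cf t).
have D : is_derive t 1 (fun t => \int[lebesgue_measure]_(s in `[-1, t]) f s) (f t).
  by apply: DeriveDef => //; rewrite -derive1E.
have := is_deriveB D (is_derive_cst (\int[lebesgue_measure]_(s in `[-1, 0]) f s) t 1).
by rewrite subr0.
Qed.

Lemma is_derive_continuous (R : realType) (f : R -> R) (t d : R) :
  is_derive t 1 f d -> {for t, continuous f}.
Proof. by move=> [df _]; apply/differentiable_continuous/derivable1_diffP. Qed.

(** * Lipschitz differential equations *)

(** Lipschitz for the sup norm; quantifying over upper bounds [e] avoids forming the norm itself. *)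
Definition sup_lipschitz (R : realType) (X : finType)
    (F : (X -> R) -> X -> R) (L : R) : Prop :=
  forall u v e, (forall y, `|u y - v y| <= e) ->
  forall x, `|F u x - F v x| <= L * e.

Lemma sup_lipschitz_continuous (R : realType) (X : finType)
    (F : (X -> R) -> X -> R) (L : R) (u : R -> X -> R) (x : X) (t : R) :
  0 < L -> sup_lipschitz R X F L ->
  (forall y, {for t, continuous (u^~ y)}) ->
  {for t, continuous (fun s => F (u s) x)}.
Proof.
move=> L0 FL cu; apply/cvgrPdist_le => e e0.
have eL : 0 < e / L by rewrite divr_gt0.
have /filter_forall : forall y, \forall s \near t, `|u t y - u s y| <= e / L.
  by move=> y; move/cvgrPdist_le: (cu y) => /(_ _ eL).
apply: filterS => s us.
by apply: (le_trans (FL _ _ _ us x)); rewrite mulrCA divff ?mulr1 ?gt_eqF.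
Qed.

(* Negative times are clamped to 0: only times [t >= 0] are meaningful, yet the
   integrand is continuous on the whole line. *)
Fixpoint picard (R : realType) (X : finType) (F : (X -> R) -> X -> R)
    (u0 : X -> R) (n : nat) (t : R) (x : X) : R :=
  if n is m.+1
  then u0 x + primitive R (fun s => F (picard R X F u0 m (Num.max s 0)) x) t
  else u0 x.

Section Picard.
Context (R : realType) (X : finType) (F : (X -> R) -> X -> R) (L : R).
Hypotheses (L0 : 0 < L) (FL : sup_lipschitz R X F L).
Variable u0 : X -> R.
Local Notation it := (picard R X F u0).

Lemma continuous_max0 (v : R -> R) :
  (forall t : R, 0 <= t -> {for t, continuous v}) ->
  continuous (fun s : R => v (Num.max s 0)).
Proof.
move=> cv t; apply: (@continuous_comp _ _ _ (fun s : R => Num.max s 0) v).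
  by apply: continuous_max; [exact: cvg_id|exact: cvg_cst].
by apply: cv; rewrite le_max lexx orbT.
Qed.

Lemma picard_continuous (n : nat) (x : X) (t : R) : 0 <= t -> {for t, continuous (it n ^~ x)}.
Proof.
elim: n x t => [|n IH] x t t0 /=; first exact: cvg_cst.
apply: cvgD; first exact: cvg_cst.
apply: is_derive_continuous; apply: is_derive_primitive => // s.
apply: (@sup_lipschitz_continuous R X F L (fun r => it n (Num.max r 0)) _ _ L0 FL) => y.
apply: (continuous_max0 (it n ^~ y) _ s) => r; exact: IH.
Qed.

Lemma is_derive_picard (n : nat) (x : X) (t : R) : 0 <= t ->
  is_derive t 1 (it n.+1 ^~ x) (F (it n t) x).
Proof.
move=> t0.
have := @is_derive_primitive R (fun s => F (it n (Num.max s 0)) x) t.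
rewrite max_l // => H.
rewrite -[F _ _]add0r; apply: is_deriveD; apply: H => // s.
apply: (@sup_lipschitz_continuous R X F L (fun r => it n (Num.max r 0)) _ _ L0 FL) => y.
by apply: (continuous_max0 (it n ^~ y)) => r; exact: picard_continuous.
Qed.

(** The weight of Bielecki's norm: measured against it, the Picard map contracts on the whole
    half-line at once. *)
Let E t : R := expR (2 * L * t).

Lemma is_derive_scaled_exp (c t : R) :
  is_derive t 1 (fun s => c * expR (2 * L * s)) (2 * L * c * expR (2 * L * t)).
Proof.
have d1 : is_derive t 1 (fun s : R => 2 * L * s) (2 * L).
  by have := is_deriveZ (2 * L) (is_derive_id t 1); rewrite -[(_ *: 1)]/(_ * 1) mulr1.
have := is_deriveZ c (is_derive1_comp (is_derive_expR (2 * L * t)) d1).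
rewrite -[_ *: _]/(_ * _) => /is_derive_eq; apply; ring.
Qed.

Lemma continuous_within_segment (f : R -> R) (T : R) :
  (forall t : R, 0 <= t -> {for t, continuous f}) -> {within `[0, T], continuous f}.
Proof.
move=> cf; apply: continuous_in_subspaceT => t.
by rewrite inE /= in_itv /= => /andP[t0 _]; exact: cf.
Qed.

(* The factor 2 L in the exponent makes each integration gain a factor 1/2. *)
Lemma exp_dist_le (g dg : R -> R) (c T : R) : 0 <= c -> 0 <= T ->
  (forall t, 0 < t < T -> is_derive t 1 g (dg t)) ->
  (forall t, 0 < t < T -> `|dg t| <= L * (c * E t)) ->
  {within `[0, T], continuous g} ->
  `|g T - g 0| <= c / 2 * E T.
Proof.
move=> c0 T0 Dg dgc cg.
have -> : c / 2 * E T = c / 2 * E T - 0 by rewrite subr0.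
have D (t : R) : is_derive t 1 (fun s => c / 2 * E s) (L * (c * E t)).
  by apply: (is_derive_eq (is_derive_scaled_exp _ _)); rewrite /E; field.
apply: (@le_trans _ _ (c / 2 * E T - c / 2 * E 0)).
  apply: (@dist_le_of_derive R g (fun s => c / 2 * E s) dg
            (fun t => L * (c * E t)) T) => //.
  by apply: continuous_within_segment => t _; apply: is_derive_continuous; exact: D.
by rewrite lerD2l lerN2 mulr_ge0 ?divr_ge0 // expR_ge0.
Qed.

(** Normalised so that [|F u0 x| <= L * bnd], which starts the induction in [picard_step]. *)
Let bnd : R := (\sum_x `|F u0 x|) / L.

Let bnd_ge0 : 0 <= bnd.
Proof. by apply: divr_ge0; [exact: sumr_ge0|exact: ltW]. Qed.

Let tail_ge0 t : 0 <= 2 * bnd * E t.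
Proof. exact: mulr_ge0 (mulr_ge0 _ bnd_ge0) (expR_ge0 _). Qed.

Lemma picard_step (n : nat) (x : X) (t : R) : 0 <= t ->
  `|it n.+1 t x - it n t x| <= bnd * 2^-1 ^+ n * E t.
Proof.
have at0 m y : it m 0 y = u0 y by case: m => //= m; rewrite primitive0 addr0.
elim: n x t => [|n IH] x t t0.
  rewrite -[it 0 t x]/(u0 x) -(at0 1%N x) expr0 mulr1.
  (* The first integration gains a factor 1/2 as well; it is given away here. *)
  apply: (@le_trans _ _ (bnd / 2 * E t)); last first.
    rewrite ler_wpM2r ?expR_ge0 // ler_pdivrMr // ler_peMr //.
    by rewrite ler1n.
  apply: (@exp_dist_le (it 1 ^~ x) (fun=> F u0 x)) => // [s /andP[s0 _]|s /andP[s0 _]|].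
  - exact: is_derive_picard (ltW s0).
  - rewrite mulrA (mulrC L) divfK ?gt_eqF //.
    apply: (@le_trans _ _ (\sum_y `|F u0 y|)).
      by rewrite (bigD1 x) //= lerDl sumr_ge0.
    rewrite ler_peMr ?sumr_ge0 // -expR0 ler_expR !mulr_ge0 // ?ltW //.
  - by apply: continuous_within_segment => s; exact: picard_continuous.
have -> : it n.+2 t x - it n.+1 t x =
  (fun s => it n.+2 s x - it n.+1 s x) t - (fun s => it n.+2 s x - it n.+1 s x) 0.
  by rewrite !at0 subrr subr0.
have -> : bnd * 2^-1 ^+ n.+1 * E t = bnd * 2^-1 ^+ n / 2 * E t.
  by rewrite exprS; field.
apply: (@exp_dist_le (fun s => it n.+2 s x - it n.+1 s x)
  (fun s => F (it n.+1 s) x - F (it n s) x) (bnd * 2^-1 ^+ n)) => //.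
- by rewrite mulr_ge0 ?exprn_ge0.
- move=> s /andP[/ltW s0 _]; have := is_derive_picard n.+1 x s s0.
  have := is_derive_picard n x s s0 => A B; exact: is_deriveB B A.
- by move=> s /andP[/ltW s0 _]; apply: FL => y; exact: IH.
- by apply: continuous_within_segment => s s0; apply: cvgB; exact: picard_continuous.
Qed.

Lemma picard_tail (n k : nat) (x : X) (t : R) : 0 <= t ->
  `|it (n + k) t x - it n t x| <= 2 * bnd * E t * 2^-1 ^+ n.
Proof.
(* The telescoped geometric sum is kept exact: the bound with [2^-1 ^+ n] alone is not stable under
   induction on [k]. *)
move=> t0; suff : `|it (n + k) t x - it n t x| <=
    2 * bnd * E t * (2^-1 ^+ n - 2^-1 ^+ (n + k)).
  move=> /le_trans; apply; apply: ler_wpM2l; first exact: tail_ge0.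
  by rewrite lerBlDr lerDl exprn_ge0.
elim: k => [|k IH]; first by rewrite addn0 !subrr normr0 mulr0.
have := picard_step (n + k) x t t0; rewrite addnS exprS.
move=> step; rewrite -(subrKA (it (n + k) t x)).
apply: (le_trans (ler_normD _ _)); apply: (le_trans (lerD step IH)).
by rewrite le_eqVlt; apply/orP; left; apply/eqP; field.
Qed.

(** The tail bound makes the iterates Cauchy at each [t >= 0]; letting [k] tend to infinity in it
    gives the rate. *)
Lemma picard_limit : exists v : R -> X -> R, forall (n : nat) (x : X) (t : R), 0 <= t ->
  `|v t x - it n t x| <= 2 * bnd * E t * 2^-1 ^+ n.
Proof.
pose v (t : R) (x : X) : R := lim (it n t x @[n --> \oo]).
exists v => n x t t0.
have cv : it n t x @[n --> \oo] --> v t x.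
  apply/cauchy_cvgP; apply: cauchy_exP => e e0.
  have [m me] := half_pow_lt R (2 * bnd * E t) e e0.
  exists (it m t x); exists m => // k /= mk.
  rewrite -(subnKC mk) -ball_normE /= distrC.
  exact: (le_lt_trans (picard_tail _ _ _ _ t0)).
apply/ler_addgt0Pr => e e0.
have [N _ Nv] : \forall m \near \oo, `|v t x - it m t x| <= e.
  by move/cvgrPdist_le : cv; apply.
have := Nv (n + N)%N (leq_addl _ _) => /= H1.
have H2 := picard_tail n N x t t0.
rewrite -(subrKA (it (n + N) t x)) addrC.
by apply: (le_trans (ler_normD _ _)); exact: lerD.
Qed.

(** The limit [v] is at first only continuous. Integrating [F v] gives a differentiable [u], and
    [u = v] because the iterates converge to both. *)
Lemma picard_solution : exists u : R -> X -> R,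
  u 0 = u0 /\ forall (t : R) (x : X), 0 <= t -> is_derive t 1 (u^~ x) (F (u t) x).
Proof.
have [v vP] := picard_limit.
have cv x : continuous (fun s : R => v (Num.max s 0) x).
  move=> t; apply/cvgrPdist_le => e e0.
  (* Times near [t] stay below [|t| + 1], so the approximation error is uniform there and a
     three-epsilon argument applies. *)
  pose b := 2 * bnd * E (`|t| + 1).
  have e3 : 0 < e / 3 by rewrite divr_gt0.
  have [n nb] := half_pow_lt R b _ e3.
  have near_v (s : R) : s <= `|t| + 1 ->
      `|v (Num.max s 0) x - it n (Num.max s 0) x| <= e / 3.
    move=> st; apply: le_trans (ltW nb).
    apply: (le_trans (vP n x _ _)); first by rewrite le_max lexx orbT.
    apply: ler_wpM2r; first by rewrite exprn_ge0.
    apply: ler_wpM2l; first exact: mulr_ge0 _ bnd_ge0.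
    rewrite ler_expR ler_wpM2l ?mulr_ge0 ?(ltW L0) //.
    by rewrite ge_max st addr_ge0.
  have ci : {for t, continuous (fun s : R => it n (Num.max s 0) x)}.
    by apply: (continuous_max0 (it n ^~ x)) => r; exact: picard_continuous.
  have tt : t < `|t| + 1 by rewrite (le_lt_trans (ler_norm _)) // ltrDl.
  have : \forall s \near t, s <= `|t| + 1 by apply: filterS (lt_nbhsl tt) => s /ltW.
  have : \forall s \near t, `|it n (Num.max t 0) x - it n (Num.max s 0) x| <= e / 3.
    by move/cvgrPdist_le : ci; apply.
  apply: filterS2 => s H2 /near_v H3; have H1 := near_v t (ltW tt).
  move: H1 H2 H3; move: (v _ x) (v _ x) (it n _ x) (it n _ x) => a b1 c d.
  rewrite !ler_norml; lra.
have cF x : continuous (fun s : R => F (v (Num.max s 0)) x).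
  by move=> t; apply: (@sup_lipschitz_continuous R X F L (fun r => v (Num.max r 0)) _ _ L0 FL) => y; exact: cv.
pose u (t : R) (x : X) := u0 x + primitive R (fun s => F (v (Num.max s 0)) x) t.
have Du (t : R) (x : X) : 0 <= t -> is_derive t 1 (u^~ x) (F (v t) x).
  move=> t0; have := is_derive_primitive R _ t (cF x) t0.
  by rewrite max_l // => H; rewrite -[F _ _]add0r; apply: is_deriveD.
have u00 : u 0 = u0 by apply/funext => x; rewrite /u primitive0 addr0.
have uv (t : R) : 0 <= t -> u t = v t.
  move=> t0; apply/funext => x; apply/subr0_eq.
  apply: (@half_pow_eq0 _ (2 * bnd * E t)) => n.
  have H1 := vP n.+1 x t t0.
  have H2 : `|u t x - it n.+1 t x| <= 2 * bnd * 2^-1 ^+ n / 2 * E t.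
    have -> : u t x - it n.+1 t x =
      (fun s => u s x - it n.+1 s x) t - (fun s => u s x - it n.+1 s x) 0.
      by rewrite u00 /= primitive0 addr0 subrr subr0.
    apply: (@exp_dist_le (fun s => u s x - it n.+1 s x)
      (fun s => F (v s) x - F (it n s) x) (2 * bnd * 2^-1 ^+ n)) => //.
    - apply: mulr_ge0; first exact: mulr_ge0 _ bnd_ge0.
      by rewrite exprn_ge0.
    - by move=> s /andP[/ltW s0 _]; apply: is_deriveB (Du _ _ s0) (is_derive_picard n x s s0).
    - move=> s /andP[/ltW s0 _]; apply: FL => y.
      by apply: (le_trans (vP n y s s0)); rewrite le_eqVlt; apply/orP; left; apply/eqP; ring.
    - apply: continuous_within_segment => s s0; apply: cvgB; last exact: picard_continuous.
      exact: is_derive_continuous (Du s x s0).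
  have -> : u t x - v t x = (u t x - it n.+1 t x) - (v t x - it n.+1 t x) by ring.
  apply: (le_trans (ler_normB _ _)); apply: (le_trans (lerD H2 H1)).
  by rewrite le_eqVlt; apply/orP; left; apply/eqP; rewrite exprS; field.
by exists u; split => // t x t0; rewrite uv //; exact: Du.
Qed.

(** The difference is bounded, and relative to [E] its bound is halved each time it is fed back
    through the equation; hence it vanishes. *)
Lemma lipschitz_uniqueness (u v : R -> X -> R) (T : R) : 0 <= T ->
  u 0 = v 0 ->
  (forall x, {within `[0, T], continuous (u^~ x)}) ->
  (forall x, {within `[0, T], continuous (v^~ x)}) ->
  (forall t x, 0 < t < T -> is_derive t 1 (u^~ x) (F (u t) x)) ->
  (forall t x, 0 < t < T -> is_derive t 1 (v^~ x) (F (v t) x)) ->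
  u T = v T.
Proof.
move=> T0 uv0 cu cv Du Dv.
have cd x : {within `[0, T], continuous (fun t => u t x - v t x)}.
  by move=> t; apply: cvgB; [exact: cu|exact: cv].
have [B B0 Bd] : exists2 B, 0 <= B &
    forall t x, 0 <= t <= T -> `|u t x - v t x| <= B.
  have /choice[c cP] : forall x, exists c, forall t, 0 <= t <= T ->
      `|u t x - v t x| <= c.
    move=> x; have cn : {within `[0, T], continuous (fun t => `|u t x - v t x|)}.
      by move=> t; apply: cvg_norm; exact: cd.
    have [c _ cmax] := EVT_max T0 cn.
    by exists `|u c x - v c x| => t tT; apply: cmax; rewrite in_itv.
  exists (\sum_x `|c x|); first by rewrite sumr_ge0.
  move=> t x tT; apply: (le_trans (cP x t tT)).
  by rewrite (le_trans (ler_norm _)) // (bigD1 x) //= lerDl sumr_ge0.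
have halve n (t : R) (x : X) : 0 <= t <= T -> `|u t x - v t x| <= B * 2^-1 ^+ n * E t.
  elim: n t x => [|n IH] t x /andP[t0 tT].
    rewrite expr0 mulr1 (le_trans (Bd t x _)) ?t0 //.
    by rewrite ler_peMr // -expR0 ler_expR !mulr_ge0 // ltW.
  have -> : u t x - v t x =
    (fun s => u s x - v s x) t - (fun s => u s x - v s x) 0.
    by rewrite uv0 subrr subr0.
  have -> : B * 2^-1 ^+ n.+1 * E t = B * 2^-1 ^+ n / 2 * E t.
    by rewrite exprS; field.
  apply: (@exp_dist_le (fun s => u s x - v s x)
    (fun s => F (u s) x - F (v s) x) (B * 2^-1 ^+ n)) => //.
  - by rewrite mulr_ge0 ?exprn_ge0.
  - move=> s /andP[s0 st]; have sT : 0 < s < T by rewrite s0 (lt_le_trans st).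
    exact: is_deriveB (Du s x sT) (Dv s x sT).
  - move=> s /andP[s0 st]; apply: FL => y; apply: IH.
    by rewrite (ltW s0) (ltW (lt_le_trans st tT)).
  - apply: continuous_subspaceW (cd x).
    by apply: subset_itvl; rewrite bnd_simp.
apply/funext => x; apply/subr0_eq.
apply: (@half_pow_eq0 _ (B * E T)) => n.
by rewrite mulrAC; apply: halve; rewrite T0 lexx.
Qed.

End Picard.

(** * The truncated logarithm, its entropy and reversible kernels *)

Lemma ln_sub_le (R : realType) (x y : R) : 0 < x -> 0 < y ->
  ln x - ln y <= (x - y) / y.
Proof.
move=> x0 y0; rewrite -ln_div ?posrE // mulrBl divff ?gt_eqF //.
have -> : x / y = 1 + (x / y - 1) by ring.
rewrite [leRHS]addrAC subrr add0r; apply: le_ln1Dx.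
by rewrite ltrBrDr addNr divr_gt0.
Qed.

Definition trunc_ln (R : realType) (d r : R) : R := ln (Num.max r d).

(* [r * ln r - r], continued below [d] by its tangent at [d]. *)
Definition trunc_entropy (R : realType) (d r : R) : R :=
  r * trunc_ln R d r - Num.max r d.

Section TruncatedLogarithm.
Context (R : realType) (d : R).
Hypothesis d0 : 0 < d.
Local Notation tl := (trunc_ln R d).
Local Notation te := (trunc_entropy R d).

Let max_gt0 r : 0 < Num.max r d.
Proof. by rewrite lt_max d0 orbT. Qed.

Lemma trunc_ln_id r : d <= r -> tl r = ln r.
Proof. by move=> dr; rewrite /trunc_ln max_l. Qed.

Lemma trunc_ln_homo r s : r <= s -> tl r <= tl s.
Proof.
move=> rs; rewrite /trunc_ln ler_ln ?posrE ?max_gt0 //.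
by rewrite ge_max !le_max rs lexx orbT.
Qed.

(** This is [ln_sub_le] based at the smaller argument, whose truncation is at least [d]. *)
Lemma trunc_ln_lipschitz r s : `|tl r - tl s| <= `|r - s| / d.
Proof.
wlog rs : r s / s <= r.
  move=> H; case: (leP s r) => [|/ltW] rs; first exact: H.
  by rewrite distrC (distrC r); exact: H.
rewrite !ger0_norm ?subr_ge0 ?trunc_ln_homo //.
apply: (le_trans (ln_sub_le R _ _ (max_gt0 r) (max_gt0 s))).
have m0 := max_gt0 s; have ms : d <= Num.max s d by rewrite le_max lexx orbT.
have sm : s <= Num.max s d by rewrite le_max lexx.
have mrs : Num.max r d - Num.max s d <= r - s.
  by rewrite lerBlDr ge_max; apply/andP; split; lra.
apply: (@le_trans _ _ ((r - s) / Num.max s d)).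
  by rewrite ler_wpM2r // invr_ge0 ltW.
by apply: ler_wpM2l; rewrite ?subr_ge0 // lef_pV2 ?posrE.
Qed.

(** With [a] and [c] the truncations of [s] and [r], the gap is [a * (ln a - ln c) - (a - c)],
    nonnegative by [ln_sub_le], plus [(s - a) * (ln a - ln c)], nonzero only if [s < d], when
    [a = d <= c] makes both factors nonpositive. *)
Lemma trunc_entropy_subgradient r s : tl r * (s - r) <= te s - te r.
Proof.
rewrite -subr_ge0.
set a := Num.max s d; set c := Num.max r d.
have -> : te s - te r - tl r * (s - r) = s * (ln a - ln c) - (a - c).
  by rewrite /trunc_entropy /trunc_ln -/a -/c; ring.
have a0 : 0 < a := max_gt0 s; have c0 : 0 < c := max_gt0 r.
have h : a - c <= a * (ln a - ln c).
  have := ln_sub_le R _ _ c0 a0; rewrite ler_pdivlMr //; lra.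
suff : 0 <= (s - a) * (ln a - ln c) by nra.
rewrite /a; case: (leP s d) => sd; last by rewrite subrr mul0r.
apply: mulr_le0; first by rewrite subr_le0.
by rewrite subr_le0 ler_ln ?posrE // /c le_max lexx orbT.
Qed.

Lemma trunc_ln_continuous : continuous tl.
Proof.
move=> t; apply/cvgrPdist_le => e e0.
have ed : 0 < e * d by rewrite mulr_gt0.
near=> s; apply: (le_trans (trunc_ln_lipschitz _ _)).
by rewrite ler_pdivrMr //; near: s; exact: cvgr_dist_le.
Unshelve. all: by end_near. Qed.

(** The subgradient inequalities at [r] and [h + r] trap the increment between [tl r * h] and
    [tl (h + r) * h], so the junction at [d] needs no separate case. *)
Lemma is_derive_trunc_entropy (r : R) : is_derive r 1 te (tl r).
Proof.
have H : h^-1 *: (te (h *: (1 : R) + r) - te r) @[h --> (0 : R)^'] --> tl r.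
  apply/cvgrPdist_le => e e0.
  have c : tl (h + r) @[h --> (0 : R)] --> tl r.
    rewrite -[X in _ --> tl X]add0r.
    apply: (@continuous_comp _ _ _ (fun h : R => h + r) tl); last exact: trunc_ln_continuous.
    by apply: cvgD; [exact: cvg_id|exact: cvg_cst].
  have near_r : \forall h \near (0 : R)^', `|tl r - tl (h + r)| <= e.
    by apply: nbhs_dnbhs; move/cvgrPdist_le : c; exact.
  move: near_r; apply: filterS2 (nbhs_dnbhs_neq (0 : R)) => h h0; apply: le_trans.
  rewrite -[h%:A]/(h * 1) mulr1 -[_ *: _]/(_ * _).
  have := trunc_entropy_subgradient r (h + r).
  have := trunc_entropy_subgradient (h + r) r.
  move: (te _) (te _) (tl _) (tl _) => A B C D; rewrite addrK => h1 h2.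
  rewrite -(ler_pM2r (_ : 0 < `|h|)) ?normr_gt0 // -!normrM !mulrBl.
  rewrite mulrAC mulVf // mul1r.
  have {h1} : A - B <= D * h by rewrite -(opprB B) lerNl -mulrN; move: h1; rewrite opprD addrCA subrr addr0.
  move: (C * h) (D * h) (A - B) h2 => x y m xm my.
  by rewrite distrC (distrC x y) !ger0_norm ?subr_ge0 ?lerB // (le_trans xm).
apply: DeriveDef; first by apply/cvg_ex; exists (tl r).
exact: cvg_lim H.
Qed.

(** The tangent at 1, where the slope is 0 and the value -1. *)
Lemma trunc_entropy_ge_N1 r : d <= 1 -> -1 <= te r.
Proof.
move=> d1; have := trunc_entropy_subgradient 1 r.
by rewrite {2}/trunc_entropy !(trunc_ln_id 1) // ln1 max_l //; lra.
Qed.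

(** The tangent at [expR 1], where the slope is 1 and the value 0. This growth turns an entropy
    bound into a pointwise bound. *)
Lemma trunc_entropy_ge_linear r : d <= 1 -> r - expR 1 <= te r.
Proof.
move=> d1; have := trunc_entropy_subgradient (expR 1) r.
have de : d <= expR 1 by rewrite (le_trans d1) // ltW // expR_gt1.
by rewrite {2}/trunc_entropy !(trunc_ln_id (expR 1)) // expRK max_l //; lra.
Qed.

End TruncatedLogarithm.

Lemma is_derive_finsum (R : realType) (X : finType) (h : X -> R -> R)
    (dh : X -> R) (t : R) : (forall x, is_derive t 1 (h x) (dh x)) ->
  is_derive t 1 (fun s => \sum_x h x s) (\sum_x dh x).
Proof.
move=> H; have -> : (fun s => \sum_x h x s) = \sum_x h x.
  by apply/funext => s; rewrite fct_sumE.
by elim/big_ind2 : _ => // [|? ? ? ? ? ?]; [exact: is_derive_cst|exact: is_deriveD].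
Qed.

(** Used at a minimum in time reached after time 0, where a positive derivative is contradictory. *)
Lemma is_derive_gt0_left (R : realType) (f : R -> R) (t df : R) :
  is_derive t 1 f df -> 0 < df -> 0 < t -> exists2 s, 0 <= s <= t & f s < f t.
Proof.
move=> [/cvg_ex[l fl] fE] df0 t0.
have ldf : l = df by rewrite -fE; apply/esym; exact: cvg_lim fl.
have l0 : 0 < l by rewrite ldf.
have [e /= e0 He] := cvgr_gt l fl 0 l0.
pose h := Num.min (e / 2) t.
have h0 : 0 < h by rewrite lt_min divr_gt0.
have ht : h <= t by rewrite ge_min lexx orbT.
have he : h < e by rewrite gt_min; apply/orP; left; lra.
exists (t - h); first by apply/andP; split; lra.
have := He (- h); rewrite /= sub0r opprK gtr0_norm // oppr_eq0 gt_eqF // => /(_ he isT).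
rewrite -[(- h)%:A]/(- h * 1) mulr1 -[_ *: _]/(_ * _) invrN mulNr oppr_gt0.
by rewrite pmulr_rlt0 ?invr_gt0 // subr_lt0 addrC.
Qed.

Lemma exists_pos_lower_bound (R : realType) (X : finType) (c : X -> R) :
  (forall x, 0 < c x) -> exists2 d, 0 < d & forall x, d <= c x.
Proof.
move=> c0; exists (\big[Num.min/1]_x c x).
  by elim/big_ind : _ => // x y x0 y0; rewrite lt_min x0.
by move=> x; exact: bigmin_le.
Qed.

(** Reversibility makes the weights [K x y * w x] symmetric; adding the sum with [x] and [y] swapped
    leaves factors [(l x - l y) * (u y - u x)], nonpositive since [l] is ordered like [u]. *)
Lemma dirichlet_form_le0 (R : realType) (X : finType) (K : X -> X -> R)
    (w u l : X -> R) : (forall x y, 0 <= K x y) -> (forall x, 0 <= w x) ->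
  reversible K w ->
  (forall x y, u x <= u y -> l x <= l y) ->
  inner w l (laplacian K u) <= 0.
Proof.
move=> K0 w0 rev mono.
pose c x y := K x y * w x.
have E1 : inner w l (laplacian K u) = \sum_x \sum_y c x y * l x * (u y - u x).
  apply: eq_bigr => x _; rewrite /laplacian mulr_sumr mulr_suml.
  by apply: eq_bigr => y _; rewrite /c; ring.
have E2 : inner w l (laplacian K u) = \sum_x \sum_y c x y * l y * (u x - u y).
  rewrite E1 exchange_big; apply: eq_bigr => x _; apply: eq_bigr => y _.
  by rewrite /c rev.
rewrite -(pmulr_lle0 _ (ltr0Sn R 1)) mulr_natr mulr2n {1}E1 E2 -big_split /=.
apply: sumr_le0 => x _; rewrite -big_split /=; apply: sumr_le0 => y _.
have -> : c x y * l x * (u y - u x) + c x y * l y * (u x - u y) =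
  c x y * ((l x - l y) * (u y - u x)) by ring.
apply: mulr_ge0_le0; first exact: mulr_ge0.
case: (leP (u x) (u y)) => [xy|/ltW yx].
  by rewrite mulr_le0_ge0 ?subr_le0 ?subr_ge0 ?mono.
by rewrite mulr_ge0_le0 ?subr_le0 ?subr_ge0 ?mono.
Qed.

(** [w] is invariant under every power of [K], and some point has positive mass since the total is
    1; irreducibility carries this mass to [x]. *)
Lemma steady_state_gt0 (R : realType) (X : finType) (K : X -> X -> R)
    (w : X -> R) : markov_kernel K -> irreducible_kernel K ->
  steady_state K w -> forall x, 0 < w x.
Proof.
move=> [K0 _] irr [w0 w1 ws] x.
have pow0 n y z : 0 <= kernel_pow K n y z.
  elim: n y z => [|n IH] y z /=; first exact: ler0n.
  by apply: sumr_ge0 => ? _; exact: mulr_ge0.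
have wpow n y : w y = \sum_z w z * kernel_pow K n z y.
  elim: n y => [|n IH] y.
    rewrite (bigD1 y) //= eqxx mulr1 big1 ?addr0 // => z zy.
    by rewrite (negbTE zy) mulr0.
  rewrite IH; transitivity (\sum_z \sum_v w v * K v z * kernel_pow K n z y).
    by apply: eq_bigr => z _; rewrite {1}ws mulr_suml.
  rewrite exchange_big; apply: eq_bigr => v _ /=; rewrite mulr_sumr.
  by apply: eq_bigr => z _; rewrite mulrA.
have [z wz] : exists z, 0 < w z.
  apply/not_existsP => H; have : \sum_y w y = 0.
    by apply: big1 => y _; apply/eqP; rewrite eq_le w0 leNgt; apply/andP; split=> //; apply/negP/H.
  by move=> E; move: w1; rewrite E => /esym/eqP; rewrite oner_eq0.
have [n Kn] := irr z x.
rewrite (wpow n x) (bigD1 z) //=; apply: ltr_pwDl; first exact: mulr_gt0.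
by apply: sumr_ge0 => y _; exact: mulr_ge0.
Qed.

(** * The truncated relaxation equation *)

Lemma is_derive_slopeP (R : realType) (f : R -> R) (t d : R) :
  is_derive t 1 f d <-> (s - t)^-1 * (f s - f t) @[s --> t^'] --> d.
Proof.
split=> [[/cvg_ex[l fl] fE]|H].
  have ld : l = d by rewrite -fE; apply/esym; exact: cvg_lim fl.
  apply/cvgrPdist_le => e e0.
  have /cvgrPdist_le/(_ e e0) := fl; rewrite ld !near_withinE => Hn.
  suff : \forall s \near t, s != t -> `|d - (s - t)^-1 * (f s - f t)| <= e by [].
  apply/nbhs0P; apply: filterS Hn => h Hh /= ht.
  rewrite (addrC t) addrK; move: Hh; rewrite -[h%:A]/(h * 1) mulr1; apply.
  by apply: contra_neq ht => ->; rewrite addr0.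
have fl : h^-1 *: (f (h *: (1 : R) + t) - f t) @[h --> (0 : R)^'] --> d.
  apply/cvgrPdist_le => e e0.
  have /cvgrPdist_le/(_ e e0) := H; rewrite !near_withinE => Hn.
  have {Hn} : \forall s \near t, s != t -> `|d - (s - t)^-1 * (f s - f t)| <= e := Hn.
  move=> /nbhs0P; apply: filterS => h /= Hh h0; rewrite -[h%:A]/(h * 1) mulr1.
  move: Hh; rewrite (addrC t) addrK; apply.
  by apply: contra_neq h0 => /eqP; rewrite -subr_eq0 addrK => /eqP.
by apply: DeriveDef; [apply/cvg_ex; exists d|exact: cvg_lim fl].
Qed.

(* Pointwise convergence does not see the topology of the index type, so the
   library lemma is applied to the discrete topology. *)
Lemma ptws_cvgP (R : realType) (X : finType) (F : set_system {ptws X -> R})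
    (f : {ptws X -> R}) : Filter F ->
  {ptws, F --> f} <-> forall x, (fun g => g x) @ F --> f x.
Proof. by move=> FF; exact: (@pointwise_cvgP (discrete_topology X) R^o F f FF). Qed.

Lemma has_derivative_withinP (R : realType) (X : finType) (D : set R)
    (f : R -> {ptws X -> R}) (t : R) (v : {ptws X -> R}) :
  has_derivative_within D f t v <->
  forall x, (s - t)^-1 * (f s x - f t x) @[s --> within D t^'] --> v x.
Proof. exact: ptws_cvgP. Qed.

(** The half-line is a neighbourhood of any [t > 0], so the relative derivative is the ordinary one
    there. *)
Lemma has_derivative_within_halfline (R : realType) (X : finType)
    (f : R -> {ptws X -> R}) (t : R) (v : {ptws X -> R}) (x : X) : 0 < t ->
  has_derivative_within `[0, +oo[ f t v -> is_derive t 1 (f^~ x) (v x).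
Proof.
move=> t0 /has_derivative_withinP/(_ x) H; apply/is_derive_slopeP.
apply: cvg_trans H; apply: cvg_app => A AH.
have {}AH : \forall s \near t^', `[0, +oo[%classic s -> A s := AH.
have pos : \forall s \near t^', 0 < s by apply: nbhs_dnbhs; exact: lt_nbhsr.
by apply: filterS2 AH pos => s + s0; apply; rewrite /= in_itv /= andbT ltW.
Qed.

Lemma has_derivative_within_right_cvg (R : realType) (X : finType)
    (f : R -> {ptws X -> R}) (v : {ptws X -> R}) (x : X) :
  has_derivative_within `[0, +oo[ f 0 v -> f s x @[s --> 0^'+] --> f 0 x.
Proof.
move=> /has_derivative_withinP/(_ x) H.
have H' : s^-1 * (f s x - f 0 x) @[s --> 0^'+] --> v x.
  have -> : (fun s : R => s^-1 * (f s x - f 0 x)) =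
      (fun s : R => (s - 0)^-1 * (f s x - f 0 x)).
    by apply/funext => s; rewrite subr0.
  apply: cvg_trans H; apply: cvg_app => A AH.
  have {}AH : \forall s \near (0 : R), s != 0 -> `[0, +oo[%classic s -> A s := AH.
  suff : \forall s \near (0 : R), 0 < s -> A s by [].
  apply: filterS AH => s As s0; apply: As; first by rewrite gt_eqF.
  by rewrite /= in_itv /= andbT ltW.
have idc : (s : R) @[s --> 0^'+] --> (0 : R) by exact: cvg_within.
(* Also valid at [s = 0], where the first term vanishes. *)
have -> : (fun s => f s x) = (fun s => s * (s^-1 * (f s x - f 0 x)) + f 0 x).
  apply/funext => s; have [->|s0] := eqVneq s 0; first by rewrite mul0r add0r.
  by rewrite mulrA divff // mul1r subrK.
rewrite -[X in _ --> X]add0r -[X in _ --> X + _](mul0r (v x)).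
by apply: cvgD; [exact: cvgM|exact: cvg_cst].
Qed.

Lemma C1_halfline_within_continuous (R : realType) (X : finType)
    (f df : R -> {ptws X -> R}) (M : set {ptws X -> R}) (T : R) (x : X) :
  C1_halfline M f df -> 0 < T ->
  {within `[0, T], continuous (fun t => f t x)}.
Proof.
move=> [_ Df _] T0; have c t : 0 < t -> {for t, continuous (fun t => f t x)}.
  move=> t0; apply: is_derive_continuous.
  exact: has_derivative_within_halfline (Df t (ltW t0)).
apply/(continuous_within_itvP _ T0); split.
- by move=> t; rewrite in_itv /= => /andP[t0 _]; exact: c.
- exact: has_derivative_within_right_cvg (Df 0 (lexx 0)).
- by apply: cvg_at_left_filter; exact: c.
Qed.

Definition relaxation_field (R : realType) (X : finType) (l : R -> R)
    (K : X -> X -> R) (w : X -> R) (a b : R) (p rho : X -> R) (x : X) : R :=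
  b ^- 2 * laplacian K rho x - a ^- 2 * inner w (fun y => l (rho y)) p * p x.

(** The first 1 makes the bound at least 1, [expR 1] comes from the tangent of the entropy there,
    and the inner 1 offsets the lower bound -1 of the entropy density. Only the untruncated initial
    entropy enters, so the value does not depend on [d]. *)
Definition relaxation_bound (R : realType) (X : finType) (w rho0 : X -> R) : R :=
  1 + expR 1 + \sum_x `|1 + \sum_y w y * (rho0 y * ln (rho0 y) - rho0 y)| / w x.

Section Relaxation.
Context (R : realType) (X : finType) (K : X -> X -> R) (w : X -> R).
Context (a b : R) (p : X -> R).
Hypotheses (hK : markov_kernel K) (hrev : reversible K w).
Hypothesis w_gt0 : forall x, 0 < w x.
Hypothesis w_sum1 : \sum_x w x = 1.
Hypotheses (ha : 0 < a) (hb : 0 < b).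
Hypotheses (p_gt0 : forall x, 0 < p x) (hp1 : \sum_x w x * p x = 1).
Local Notation fld d := (relaxation_field R X (trunc_ln R d) K w a b p).

Let a2 : 0 < a ^- 2. Proof. by rewrite invr_gt0 exprn_gt0. Qed.
Let b2 : 0 < b ^- 2. Proof. by rewrite invr_gt0 exprn_gt0. Qed.

Lemma relaxation_field_trunc d u : (forall x, d <= u x) ->
  fld d u = vector_field K w a b p u.
Proof.
move=> du; apply/funext => x; rewrite /relaxation_field /vector_field.
by congr (_ - _ * _ * _); apply: eq_bigr => y _; rewrite trunc_ln_id.
Qed.

(** Row sums 1 give [2 * b ^- 2] for the diffusion; the total mass 1 of [w * p] and the Lipschitz
    constant [1 / d] of [trunc_ln] give the rest, with [\sum_x p x] dominating each [p x]. *)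
Let lip d : R := 2 * b ^- 2 + a ^- 2 * (\sum_x p x) / d.

Let lip_gt0 d : 0 < d -> 0 < lip d.
Proof.
move=> d0; apply: ltr_wpDr; last by rewrite mulr_gt0.
rewrite divr_ge0 ?(ltW d0) // mulr_ge0 ?(ltW a2) // sumr_ge0 // => x _.
exact: ltW.
Qed.

Lemma relaxation_field_lipschitz d : 0 < d ->
  exists2 L, 0 < L & sup_lipschitz R X (fld d) L.
Proof.
move=> d0; exists (lip d); first exact: lip_gt0.
move=> u v e uv x; have [K0 K1] := hK.
have e0 : 0 <= e := le_trans (normr_ge0 _) (uv x).
have lapE : `|laplacian K u x - laplacian K v x| <= 2 * e.
  rewrite /laplacian -sumrB; apply: (le_trans (ler_norm_sum _ _ _)).
  rewrite -[leRHS]mul1r -{1}(K1 x) mulr_suml; apply: ler_sum => y _.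
  rewrite -mulrBr normrM ger0_norm // ler_wpM2l //.
  have -> : u y - u x - (v y - v x) = (u y - v y) - (u x - v x) by ring.
  by apply: (le_trans (ler_normB _ _)); rewrite mulr_natl mulr2n lerD.
have innE : `|inner w (fun y => trunc_ln R d (u y)) p
              - inner w (fun y => trunc_ln R d (v y)) p| <= e / d.
  rewrite /inner -sumrB; apply: (le_trans (ler_norm_sum _ _ _)).
  rewrite -[leRHS]mul1r -hp1 mulr_suml; apply: ler_sum => y _.
  have wp : 0 <= w y * p y by rewrite mulr_ge0 // ltW.
  have -> (r s : R) : r * p y * w y - s * p y * w y = w y * p y * (r - s) by ring.
  rewrite normrM (ger0_norm wp) ler_wpM2l //.
  apply: (le_trans (trunc_ln_lipschitz _ _ d0 _ _)).
  by rewrite ler_wpM2r // invr_ge0 ltW.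
have px : p x <= \sum_y p y.
  by rewrite (bigD1 x) //= lerDl sumr_ge0 // => y _; exact: ltW.
rewrite /relaxation_field; move: lapE innE.
move: (laplacian _ _ _) (laplacian _ _ _) (inner _ _ _) (inner _ _ _).
move=> B A D C AB CD.
have -> : b ^- 2 * A - a ^- 2 * C * p x - (b ^- 2 * B - a ^- 2 * D * p x) =
  b ^- 2 * (A - B) - a ^- 2 * p x * (C - D) by ring.
apply: (le_trans (ler_normB _ _)); rewrite mulrDl; apply: lerD.
  have -> : 2 * b ^- 2 * e = b ^- 2 * (2 * e) by ring.
  by rewrite normrM (gtr0_norm b2) ler_wpM2l // ltW.
have ap : 0 <= a ^- 2 * p x by rewrite mulr_ge0 // ltW.
rewrite normrM (ger0_norm ap).
have -> : a ^- 2 * (\sum_y p y) / d * e = a ^- 2 * (\sum_y p y) * (e / d) by ring.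
by apply: ler_pM => //; rewrite ler_wpM2l // ltW.
Qed.

(** * A priori bounds: entropy from above, minimum principle from below *)

Section APrioriBounds.
Context (rho0 : X -> R) (d : R) (u : R -> X -> R).
Hypotheses (d0 : 0 < d) (d1 : d <= 1) (drho0 : forall x, d <= rho0 x).
Hypothesis u0 : u 0 = rho0.
Hypothesis Du : forall (t : R) x, 0 <= t -> is_derive t 1 (u^~ x) (fld d (u t) x).

Let entropy (v : X -> R) : R := \sum_x w x * trunc_entropy R d (v x).

(** Diffusion contributes a Dirichlet form, nonpositive since [trunc_ln] is monotone; the reaction
    contributes [- a ^- 2] times the square of the pairing of the truncated logarithm with [p]. *)
Lemma entropy_nonincreasing (T : R) : 0 <= T -> entropy (u T) <= entropy (u 0).
Proof.
move=> T0.
have D (t : R) : 0 <= t -> is_derive t 1 (entropy \o u)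
    (\sum_x w x * (trunc_ln R d (u t x) * fld d (u t) x)).
  move=> t0; apply: is_derive_finsum => x.
  exact: (is_deriveZ (w x) (is_derive1_comp (is_derive_trunc_entropy R d d0 _) (Du t x t0))).
apply: (@ler0_derive1_nincr _ (entropy \o u) 0 T) => // [t|t|].
- by rewrite in_itv => /andP[/ltW/D[]].
- rewrite in_itv => /andP[/ltW t0 _]; rewrite derive1E; have [_ ->] := D t t0.
  have lapl : inner w (fun x => trunc_ln R d (u t x)) (laplacian K (u t)) <= 0.
    apply: dirichlet_form_le0 => //; first by case: hK.
      by move=> x; exact: ltW.
    by move=> x y; exact: trunc_ln_homo.
  set q := inner w (fun x => trunc_ln R d (u t x)) p.
  have -> : \sum_x w x * (trunc_ln R d (u t x) * fld d (u t) x) =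
    b ^- 2 * inner w (fun x => trunc_ln R d (u t x)) (laplacian K (u t))
    - a ^- 2 * q * inner w (fun x => trunc_ln R d (u t x)) p.
    rewrite /inner [b ^- 2 * _]mulr_sumr [a ^- 2 * q * _]mulr_sumr -sumrB; apply: eq_bigr => x _.
    by rewrite /relaxation_field -/q; ring.
  rewrite -/q -mulrA -expr2.
  have : 0 <= a ^- 2 * q ^+ 2 by rewrite mulr_ge0 ?sqr_ge0 // ltW.
  have : b ^- 2 * inner w (fun x => trunc_ln R d (u t x)) (laplacian K (u t)) <= 0.
    by rewrite pmulr_rle0.
  lra.
- by apply: continuous_within_segment => t t0; apply: is_derive_continuous (D t t0).
Qed.

Local Notation M := (relaxation_bound R X w rho0).

Lemma relaxation_upper_bound (T : R) x : 0 <= T -> u T x <= M.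
Proof.
move=> T0; have := entropy_nonincreasing T T0.
(* The initial state lies above [d], so the truncation does not affect its entropy. *)
have -> : entropy (u 0) = \sum_y w y * (rho0 y * ln (rho0 y) - rho0 y).
  rewrite u0; apply: eq_bigr => y _.
  by rewrite /trunc_entropy trunc_ln_id // max_l.
set E0 := \sum_y _ => ET.
have uE : w x * (u T x - expR 1) <= `|1 + E0|.
  apply: le_trans (ler_norm _).
  apply: (@le_trans _ _ (1 + entropy (u T))); last by rewrite lerD2l.
  rewrite -[X in X + entropy _]w_sum1 /entropy -big_split /= (bigD1 x) //=.
  rewrite -[leLHS]addr0; apply: lerD.
    rewrite -{2}[w x]mulr1 -mulrDr ler_wpM2l //; first exact: ltW.
    by have := trunc_entropy_ge_linear R d d0 (u T x) d1; lra.
  apply: sumr_ge0 => y _; rewrite -{1}[w y]mulr1 -mulrDr mulr_ge0 //.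
    exact: ltW.
  by have := trunc_entropy_ge_N1 R d d0 (u T y) d1; lra.
have : u T x - expR 1 <= `|1 + E0| / w x.
  by rewrite ler_pdivlMr // mulrC.
have : `|1 + E0| / w x <= \sum_y `|1 + E0| / w y.
  by rewrite (bigD1 x) //= lerDl sumr_ge0 // => y _; rewrite divr_ge0 // ltW.
rewrite /relaxation_bound -/E0; lra.
Qed.

Lemma relaxation_bound_ge1 : 1 <= M.
Proof.
have : 0 <= \sum_x `|1 + \sum_y w y * (rho0 y * ln (rho0 y) - rho0 y)| / w x.
  by apply: sumr_ge0 => y _; rewrite divr_ge0 // ltW.
by have := expR_gt0 (1 : R); rewrite /relaxation_bound; lra.
Qed.

(* At a minimum of [u] over [0, T] x X lying below [d], the diffusion and the
   reaction both push up: [p z * w z * ln d] outweighs the other logarithms,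
   whose total contribution is at most [ln M]. *)
Lemma relaxation_lower_bound (T : R) x :
  (forall y, ln M + p y * w y * ln d < 0) -> 0 <= T -> d <= u T x.
Proof.
move=> Md T0; rewrite leNgt; apply/negP => uTd.
have M1 := relaxation_bound_ge1.
have /choice[c cP] : forall y, exists c, 0 <= c <= T /\
    forall t, 0 <= t <= T -> u c y <= u t y.
  move=> y; have cu : {within `[0, T], continuous (u^~ y)}.
    by apply: continuous_within_segment => t t0; apply: is_derive_continuous (Du t y t0).
  have [c cT cmin] := EVT_min T0 cu; exists c; split; first by rewrite in_itv in cT.
  by move=> t tT; apply: cmin; rewrite in_itv.
(* Minimising the minima in time over the points gives the minimum over time and space. *)
pose z := [arg min_(y < x) u (c y) y]%O.
have zmin y t : 0 <= t <= T -> u (c z) z <= u t y.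
  move=> tT; apply: le_trans (proj2 (cP y) t tT).
  by rewrite /z; case: arg_minP => // i _; apply.
have [/andP[cz0 czT] _] := cP z.
have uzd : u (c z) z < d.
  by apply: le_lt_trans uTd; apply: zmin; rewrite T0 lexx.
have cz_gt0 : 0 < c z.
  rewrite lt_neqAle cz0 andbT; apply/negP => /eqP cE.
  by move: uzd; rewrite -cE u0 ltNge drho0.
have czmin y : u (c z) z <= u (c z) y by apply: zmin; rewrite cz0.
suff dpos : 0 < fld d (u (c z)) z.
  have [s /andP[s0 sc]] := is_derive_gt0_left _ _ _ _ (Du (c z) z cz0) dpos cz_gt0.
  by apply/negP; rewrite -leNgt; apply: zmin; rewrite s0 (le_trans sc).
have lap0 : 0 <= laplacian K (u (c z)) z.
  apply: sumr_ge0 => y _; rewrite mulr_ge0 ?subr_ge0 //.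
  by case: hK => + _; apply.
have inn0 : inner w (fun y => trunc_ln R d (u (c z) y)) p < 0.
  apply: le_lt_trans (Md z); rewrite /inner (bigD1 z) //= addrC; apply: lerD.
    have lM : 0 <= ln M by exact: ln_ge0.
    (* Away from [z] each truncated logarithm is at most [ln M], as [u <= M] and [d <= 1 <= M], and
       the weights [w y * p y] sum to at most 1. *)
    apply: (@le_trans _ _ (\sum_(y | y != z) ln M * (w y * p y))).
      apply: ler_sum => y _; rewrite -mulrA (mulrC (p y)) ler_wpM2r //.
        by rewrite mulr_ge0 // ltW.
      rewrite /trunc_ln ler_ln ?posrE ?lt_max ?d0 ?orbT //.
        by rewrite ge_max relaxation_upper_bound // (le_trans d1).
      exact: lt_le_trans M1.
    rewrite -mulr_sumr -[leRHS]mulr1 ler_wpM2l // -hp1 [leRHS](bigD1 z) //=.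
    by rewrite lerDr mulr_ge0 // ltW.
  rewrite /trunc_ln max_r; last exact: ltW.
  by rewrite le_eqVlt; apply/orP; left; apply/eqP; ring.
rewrite /relaxation_field; apply: ltr_wpDl; first by rewrite mulr_ge0 // ltW.
by rewrite oppr_gt0 pmulr_llt0 // pmulr_rlt0.
Qed.

End APrioriBounds.

End Relaxation.

(** * Compact boxes and global well-posedness *)

Lemma compact_ptws_box (R : realType) (X : finType) (c C : R) :
  compact ([set mu | forall x, c <= mu x <= C] : set {ptws X -> R}).
Proof.
have := @tychonoff X (fun=> R) (fun=> `[c, C]%classic) (fun=> @segment_compact R c C).
congr compact; apply/seteqP; split=> f fx x; move: (fx x);
  by rewrite /= in_itv.
Qed.

Theorem lemma4p5 (R : realType) (X : finType) (K : X -> X -> R) (w : X -> R)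
    (a b : R) (p : X -> R)
    (hK : markov_kernel K) (hirr : irreducible_kernel K)
    (hw : steady_state K w) (hrev : reversible K w)
    (ha : 0 < a) (hb : 0 < b)
    (hp : Mplus p) (hp1 : \sum_(x : X) w x * p x = 1)
    (rho0 : X -> R) (hrho0 : Mplus rho0) :
  exists rho : R -> {ptws X -> R},
    [/\ global_solution K w a b p rho0 rho,
        forall rho' : R -> {ptws X -> R},
          global_solution K w a b p rho0 rho' ->
          forall t : R, 0 <= t -> rho' t = rho t
      & exists C : set {ptws X -> R},
          [/\ compact C, C `<=` @Mplus R X
            & [set rho t | t in `[0, +oo[] `<=` C]].
Proof.
have w_gt0 := steady_state_gt0 _ _ _ _ hK hirr hw.
have [_ w1 _] := hw.
have p0 : forall x, 0 < p x := hp.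
have r0 : forall x, 0 < rho0 x := hrho0.
pose M := relaxation_bound R X w rho0.
pose F d := relaxation_field R X (trunc_ln R d) K w a b p.
have pw x : 0 < p x * w x by rewrite mulr_gt0.
have [d [d0 d1 dr dM]] : exists d, [/\ 0 < d, d <= 1, forall x, d <= rho0 x
    & forall x, ln M + p x * w x * ln d < 0].
  (* The exponential bound gives [p x * w x * ln d <= - ln M - p x * w x], where the final [- 1]
     provides strictness. There is no circularity, as [M] is fixed before [d]. *)
  have [d d0 dc] := exists_pos_lower_bound R X
    (fun x => Num.min (rho0 x) (expR (- (ln M / (p x * w x)) - 1)))
    (fun x => ltac:(by rewrite lt_min r0 expR_gt0)).
  exists (Num.min 1 d); split; first by rewrite lt_min ltr01.
  - by rewrite ge_min lexx.
  - by move=> x; rewrite ge_min; have := dc x; rewrite le_min => /andP[->]; rewrite orbT.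
  move=> x; have : ln (Num.min 1 d) <= - (ln M / (p x * w x)) - 1.
    rewrite -[leRHS]expRK ler_ln ?posrE ?expR_gt0 ?lt_min ?ltr01 //.
    by rewrite ge_min; have := dc x; rewrite le_min => /andP[_ ->]; rewrite orbT.
  rewrite -(ler_pM2l (pw x)) mulrBr mulr1 mulrN mulrCA divff ?gt_eqF // mulr1.
  by have := pw x; lra.
have [L L0 FL] := relaxation_field_lipschitz _ _ _ _ _ _ _ hK w_gt0 ha hb p0 hp1 d d0.
have [u [u0 Du]] := picard_solution R X (F d) L L0 FL rho0.
have lo t x : 0 <= t -> d <= u t x.
  exact: (relaxation_lower_bound _ _ _ _ _ _ _ hK hrev w_gt0 w1 ha hb p0 hp1
            rho0 d u d0 d1 dr u0 Du).
have up t x : 0 <= t -> u t x <= M.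
  exact: (relaxation_upper_bound _ _ _ _ _ _ _ hK hrev w_gt0 w1 ha hb
            rho0 d u d0 d1 dr u0 Du).
exists u; split.
- split=> //; exists (fun t => F d (u t)); split; last first.
    by move=> t t0; apply: relaxation_field_trunc => x; exact: lo.
  split.
  + by move=> t t0 x; exact: lt_le_trans (lo t x t0).
  + move=> t t0; apply/has_derivative_withinP => x.
    have /is_derive_slopeP := Du t x t0; apply: cvg_trans.
    by apply: cvg_app; exact: cvg_within.
  + apply: continuous_in_subspaceT => t; rewrite inE /= in_itv /= andbT => t0.
    apply/ptws_cvgP => x.
    apply: (sup_lipschitz_continuous R X (F d) L u x t L0 FL) => y.
    exact: is_derive_continuous (Du t y t0).
- move=> v [v0 [dv [v1 vE]]] T; rewrite le_eqVlt => /predU1P[<-|T0].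
    by rewrite v0 u0.
  have cv x := C1_halfline_within_continuous _ _ _ _ _ _ x v1 T0.
  have [Mv Dv _] := v1.
  have /choice[c cP] : forall x, exists c, 0 < c /\
      forall t, 0 <= t <= T -> c <= v t x.
    move=> x; have [c cT cmin] := EVT_min (ltW T0) (cv x).
    exists (v c x); split; last by move=> t tT; apply: cmin; rewrite in_itv.
    by move: cT; rewrite in_itv /= => /andP[/Mv].
  (* Below [d] and below the minima of the second solution on [[0, T]], so truncation at [d'] is
     invisible to both solutions. *)
  have [d' d'0 d'c] := exists_pos_lower_bound R X (fun x => Num.min d (c x))
    (fun x => ltac:(by rewrite lt_min d0 (proj1 (cP x)))).
  have [L' L'0 FL'] :=
    relaxation_field_lipschitz _ _ _ _ _ _ _ hK w_gt0 ha hb p0 hp1 d' d'0.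
  apply: (lipschitz_uniqueness R X (F d') L' L'0 FL' v u T (ltW T0)) => //.
  + by rewrite v0 u0.
  + by move=> x; apply: continuous_within_segment => t t0; apply: is_derive_continuous (Du t x t0).
  + move=> t x /andP[t0 tT].
    rewrite /F relaxation_field_trunc; last first.
      move=> y; have := d'c y; rewrite le_min => /andP[_ /le_trans]; apply.
      by apply: (proj2 (cP y)); rewrite (ltW t0) (ltW tT).
    rewrite -vE; last exact: ltW.
    exact: has_derivative_within_halfline (Dv t (ltW t0)).
  + move=> t x /andP[/ltW t0 tT].
    rewrite /F relaxation_field_trunc; last first.
      move=> y; have := d'c y; rewrite le_min => /andP[/le_trans + _]; apply.
      exact: lo.
    (* [u] was built with truncation at [d]; since it stays above both levels, the two truncated
       fields agree along it. *)
    rewrite -(relaxation_field_trunc _ _ _ _ _ _ _ d); last by move=> y; exact: lo.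
    exact: Du.
- exists [set mu | forall x, d <= mu x <= M]; split.
  + exact: compact_ptws_box.
  + by move=> mu mub x; have /andP[+ _] := mub x; exact: lt_le_trans.
  + move=> _ [t + <-] x; rewrite /= in_itv /= andbT => t0.
    by rewrite lo ?up.
Qed.
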